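(* Let $p>1$ and let $f,F$ be real numbers with $f>0$ and $f^p\le F$. Then there exists a unique function $g:(0,1]\to\mathbb{R}^+$ that is non-increasing and continuous, satisfies $\int_0^1 g(u)\,du=f$ and $\int_0^1 g^p(u)\,du=F$, and is such that $$\int_0^1\Big(\frac1t\int_0^t g(u)\,du\Big)^p dt=F\,\omega_p(f^p/F)^p.$$
   Context: $\mathbb{R}^+$ denotes the non-negative real numbers. For $p>1$, $\omega_p:[0,1]\to\big[1,\frac{p}{p-1}\big]$ denotes the inverse function $H_p^{-1}$ of $H_p:\big[1,\frac{p}{p-1}\big]\to[0,1]$, $H_p(z)=-(p-1)z^p+pz^{p-1}$ (a strictly decreasing bijection). *)

(* Defs.v *)
From HB Require Import structures.
From mathcomp Require Import all_boot all_order all_algebra.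
From mathcomp Require Import all_classical all_reals all_analysis.

Set Implicit Arguments.
Unset Strict Implicit.
Unset Printing Implicit Defensive.

Import Order.TTheory GRing.Theory Num.Theory.
Import numFieldNormedType.Exports.

Local Open Scope classical_set_scope.
Local Open Scope ring_scope.

Definition Hp (R : realType) (p z : R) : R :=
  - (p - 1) * z `^ p + p * z `^ (p - 1).

(* Inverse of [Hp p : [1, p/(p-1)] -> [0, 1]], a bijection when [1 < p].
   The default value 0 is only returned outside of [0, 1]. *)
Definition omega (R : realType) (p : R) : R -> R :=
  'pinv_(fun=> 0) `[1, p / (p - 1)] (Hp p).

Local Open Scope ereal_scope.

(* A function on (0, 1] is represented by a total [g : R -> R] of which only
   the values on (0, 1] are constrained. All integrals are extended-real
   valued, so that equating one with a real number includes its finiteness. *)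
Definition extremizer (R : realType) (p f F : R) (g : R -> R) : Prop :=
  let mu := @lebesgue_measure R in
  [/\ {in `]0%R, 1%R], forall t, (0 <= g t)%R},
      {in `]0%R, 1%R] &, nonincreasing_fun g}
    & {within `]0%R, 1%R], continuous g}] /\
  [/\ \int[mu]_(u in `]0%R, 1%R]) (g u)%:E = f%:E,
      \int[mu]_(u in `]0%R, 1%R]) (g u `^ p)%:E = F%:E
    & \int[mu]_(t in `]0%R, 1%R])
        ((t^-1)%:E * \int[mu]_(u in `]0%R, t]) (g u)%:E) `^ p
      = (F * omega p (f `^ p / F) `^ p)%:E].

(* Main.v *)
(* Write z = omega_p(f^p/F), so that z^p F = (integral of G^p) where
   G(t) = (1/t) \int_0^t g.  Integrating (t G^p)' = p G^(p-1) g - (p-1) G^p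
   gives f^p = p \int G^(p-1) g - (p-1) \int G^p, and inserting H_p(z) = f^p/F
   shows that Young's inequality p G^(p-1) (z g) <= (z g)^p + (p-1) G^p holds
   with equality after integration.  By continuity G = z g everywhere, and this
   differential equation forces g(u) = (f/z) u^(1/z-1).  Conversely this power
   function has all the required integrals. *)
Require Import Defs.
From HB Require Import structures.
From mathcomp Require Import all_boot all_order all_algebra.
From mathcomp Require Import all_classical all_reals all_analysis.
From mathcomp Require Import measurable_realfun ring lra.

Set Implicit Arguments.
Unset Strict Implicit.
Unset Printing Implicit Defensive.

Import Order.TTheory GRing.Theory Num.Theory.
Import numFieldNormedType.Exports.

Local Open Scope classical_set_scope.
Local Open Scope ring_scope.

Local Notation mu := (@lebesgue_measure _).

(** * Strict Young inequality *)

(** Strict convexity: the graph of [x ^ p] lies strictly above its tangent at 1 away from the point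
    of contact. The point 0 is split off because the argument goes through [ln x]. *)
Lemma powR_tangent_lt (R : realType) (p x : R) :
  1 < p -> 0 <= x -> x != 1 -> p * x < x `^ p + (p - 1).
Proof.
move=> p1; rewrite le_eqVlt => /predU1P[<- _|x0 x1].
  by rewrite mulr0 powR0 ?gt_eqF ?add0r ?subr_gt0// (lt_trans _ p1).
have lnx0 : ln x != 0 by rewrite ln_eq0.
(* Weighted AM-GM: [1 + y <= expR y] at [y = (p - 1) * ln x] and [y = - ln x]. *)
have h1 : 1 + (p - 1) * ln x < x `^ (p - 1).
  rewrite /powR gt_eqF//; apply: expR_gt1Dx.
  by rewrite mulf_neq0// subr_eq0 gt_eqF.
have h2 : 1 - ln x <= x^-1.
  by rewrite (le_trans (expR_ge1Dx _))// expRN lnK.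
have : x * p < x * (x `^ (p - 1) + (p - 1) * x^-1).
  rewrite ltr_pM2l//.
  have : (p - 1) * (1 - ln x) <= (p - 1) * x^-1 by rewrite ler_pM2l// subr_gt0.
  lra.
rewrite mulrDr mulr_powRB1 ?(ltW x0)//; last by rewrite (lt_trans _ p1).
by rewrite mulrCA divff ?gt_eqF// mulr1 mulrC.
Qed.

(** The tangent inequality at [a / b], multiplied by [b ^ p]. Its strictness off the diagonal is
    what later forces the equality [z * h t = G t]. *)
Lemma powR_young_lt (R : realType) (p a b : R) :
  1 < p -> 0 < b -> 0 <= a -> a != b ->
  p * b `^ (p - 1) * a < a `^ p + (p - 1) * b `^ p.
Proof.
move=> p1 b0 a0 ab.
have ab0 : 0 <= a / b by rewrite divr_ge0// ltW.
have ab1 : a / b != 1.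
  by apply: contra ab => /eqP ab1; rewrite -(divfK (lt0r_neq0 b0) a) ab1 mul1r.
have := powR_tangent_lt p1 ab0 ab1.
rewrite -(@ltr_pM2r _ (b `^ p)) ?powR_gt0// mulrDl -powRM ?(ltW b0)//.
rewrite divfK ?gt_eqF// -(@mulr_powRB1 _ b p) ?(ltW b0)// ?(lt_trans _ p1)//.
suff -> : p * (a / b) * (b * b `^ (p - 1)) = p * b `^ (p - 1) * a by [].
by field; rewrite gt_eqF.
Qed.

(** * The function [Hp] and its inverse *)

Lemma derivable_Hp (R : realType) (p z : R) : 0 < z -> derivable (Hp p) z 1.
Proof.
move=> z0; rewrite /Hp; apply: derivableD; apply: derivableM => //;
by apply: ex_derive; exact: is_derive1_powR.
Qed.

(** [Hp p] takes the values 1 and 0 at the ends of the interval, so it is onto []0, 1]] by the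
    intermediate value theorem, and a partial inverse of a surjection is a right inverse. The upper
    bound is strict because [Hp p] vanishes at [p / (p - 1)] while [v] is positive. *)
Lemma omegaP (R : realType) (p v : R) : 1 < p -> 0 < v <= 1 ->
  [/\ 1 <= omega p v, omega p v < p / (p - 1) & Hp p (omega p v) = v].
Proof.
move=> p1 /andP[v0 v1].
have p10 : 0 < p - 1 by rewrite subr_gt0.
have p0 : 0 < p by rewrite (lt_trans _ p1).
have H1 : Hp p 1 = 1 by rewrite /Hp !powR1 !mulr1; ring.
have c0 : 0 < p / (p - 1) by rewrite divr_gt0.
have c1 : 1 <= p / (p - 1) by rewrite ler_pdivlMr// mul1r gerBl.
have Hc : Hp p (p / (p - 1)) = 0.
  rewrite /Hp -(@mulr_powRB1 _ (p / (p - 1)) p) ?(ltW c0)//.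
  by field; rewrite gt_eqF.
have surj : set_surj `[1, p / (p - 1)] `]0, 1] (Hp p).
  move=> w /=; rewrite in_itv/= => /andP[w0 w1].
  have [||z zI <-] := @IVT R (Hp p) 1 (p / (p - 1)) w c1.
  - apply: derivable_within_continuous => z; rewrite in_itv/= => /andP[z1 _].
    by apply: derivable_Hp; rewrite (lt_le_trans _ z1).
  - by rewrite H1 Hc ge_min (ltW w0) orbT le_max w1.
  - by exists z.
have vI : v \in `]0, 1]%classic by rewrite inE/= in_itv/= v0 v1.
have Hv : Hp p (omega p v) = v by exact: surjpK surj _ vI.
have : omega p v \in `[1, p / (p - 1)].
  by apply: (surjpinv_image_sub surj); exists v => //; rewrite -inE.
rewrite in_itv/= => /andP[z1]; rewrite le_eqVlt => /predU1P[zc|//].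
by move: v0; rewrite -Hv zc Hc ltxx.
Qed.

(** * Antiderivatives and means on []0, 1]] *)

(** Turns an integral condition into calculus. As [k] may blow up at 0, the antiderivative is only
    continuous there, and it is differentiated in the open interval alone. *)
Lemma integral_unit_antiderivative (R : realType) (k : R -> R) (c : R) :
  {in `]0, 1], forall t, 0 <= k t} -> {within `]0, 1], continuous k} ->
  (\int[mu]_(u in `]0%R, 1%R]) (k u)%:E = c%:E)%E ->
  exists P : R -> R,
  [/\ P 0 = 0, P 1 = c, {within `[0, 1], continuous P},
      {in `]0, 1[, forall t : R, is_derive t 1 P (k t)} &
      {in `]0, 1], forall t,
        (\int[mu]_(u in `]0%R, t]) (k u)%:E = (P t)%:E)%E}].
Proof.
move=> k0 ck kc; pose P := parameterized_integral mu 0 ^~ k.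
have ik : mu.-integrable `]0, 1] (EFin \o k).
  apply/integrableP; split.
    by apply/measurable_EFinP; exact: subspace_continuous_measurable_fun.
  apply: (@le_lt_trans _ _ c%:E); last exact: ltry.
  rewrite -kc le_eqVlt; apply/orP; left; apply/eqP/eq_integral => x xI.
  by rewrite /= ger0_norm//; apply: k0; rewrite inE in xI.
have ikt t : t \in `]0, 1] -> mu.-integrable `]0, t] (EFin \o k).
  rewrite in_itv/= => /andP[_ t1]; apply: integrableS ik => //.
  exact: subset_itvl.
(* The fundamental theorem is applied from the closed end 0; adding this null point changes neither
   measurability nor the integral. *)
have ik' : mu.-integrable `[0, 1] (EFin \o k).
  apply/integrableP; split.
    by apply/emeasurable_fun_itv_obnd_cbndP; exact: measurable_int ik.
  rewrite -integral_itv_obnd_cbnd; first by case/integrableP: ik.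
  by apply: measurableT_comp => //; exact: measurable_int ik.
have PE t : t \in `]0, 1] -> P t = \int[mu]_(u in `]0, t]) k u.
  by move=> tI; rewrite /P /parameterized_integral Rintegral_itv_obnd_cbnd//; exact: ikt.
exists P; split.
- by rewrite /P /parameterized_integral set_itv1 Rintegral_set1.
- by rewrite PE ?in_itv/= ?ltr01 ?lexx// /Rintegral kc.
- exact: parameterized_integral_continuous.
- move=> t tI.
  have [t0 t1] : 0 < t /\ t < 1 by move: tI; rewrite in_itv/= => /andP.
  have ckt : {for t, continuous k}.
    apply/(@within_continuous_continuous _ _ _ (t / 2) 1) => //.
    + lra.
    + apply: continuous_subspaceW ck; apply: subset_itvr; rewrite bnd_simp; lra.
    + rewrite in_itv/= t1 andbT; lra.
  have [] := @continuous_FTC1_closed _ k 0 t 1 t1 ik' t0 ckt.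
  by move=> dP <-; rewrite derive1E; exact: derivableP.
- move=> t tI; rewrite PE// /Rintegral fineK//.
  exact: (integrable_fin_num _ (ikt t tI)).
Qed.

(** The mean value theorem gives [P t = t * k c] with [0 < c < t], and [k t <= k c]. *)
Lemma antiderivative_ge (R : realType) (k P : R -> R) (t : R) :
  {in `]0, 1] &, nonincreasing_fun k} -> P 0 = 0 ->
  {within `[0, 1], continuous P} ->
  {in `]0, 1[, forall t : R, is_derive t 1 P (k t)} ->
  t \in `]0, 1] -> t * k t <= P t.
Proof.
move=> kni P0 cP dP tI.
have [t0 t1] : 0 < t /\ t <= 1 by move: tI; rewrite in_itv/= => /andP.
have [||c] := @MVT _ P k 0 t t0.
- move=> x; rewrite in_itv/= => /andP[x0 xt].
  by apply: dP; rewrite in_itv/= x0 (lt_le_trans xt).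
- by apply: continuous_subspaceW cP; exact: subset_itvl.
rewrite in_itv/= P0 !subr0 => /andP[c0 ct ->].
rewrite mulrC ler_pM2r//; apply: kni => //; last exact: ltW.
by rewrite in_itv/= c0 (le_trans (ltW ct)).
Qed.

(** The absolute value makes the statement true at 0: [powR] takes the default value 1 on negative
    numbers and would jump there. *)
Lemma continuous_powR_norm (R : realType) (p : R) :
  0 < p -> continuous (fun x : R => `|x| `^ p).
Proof.
move=> p0 x; have [->|x0] := eqVneq x 0.
  have cvg0 : (fun y : R => `|y| `^ p) y @[y --> 0] --> `|0 : R| `^ p.
    apply/cvgrPdist_lt => e e0.
    (* The radius is [e ^ (1 / p)], whose [p]-th power is [e]. *)
    apply: filterS (@nbhs0_lt _ R _ (powR_gt0 p^-1 e0)) => y ye.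
    rewrite normr0 powR0 ?gt_eqF// sub0r normrN ger0_norm ?powR_ge0//.
    rewrite -[ltRHS](@powRr1 _ e) ?(ltW e0)// -(mulVf (lt0r_neq0 p0)) powRrM.
    by apply: gt0_ltr_powR; rewrite ?nnegrE ?powR_ge0.
  exact: cvg0.
have cp : {for `|x|, continuous (@powR R ^~ p)}.
  apply/differentiable_continuous/derivable1_diffP/derivable_powR.
  by rewrite in_itv/= andbT normr_gt0.
exact: (@continuous_comp _ _ _ _ (@powR R ^~ p) x (@norm_continuous R R x) cp).
Qed.

Lemma within_continuous_powR (R : realType) (p : R) (D : set R) (k : R -> R) :
  0 < p -> {in D, forall t, 0 <= k t} -> {within D, continuous k} ->
  {within D, continuous (fun t => k t `^ p)}.
Proof.
move=> p0 k0 ck; apply: (@subspace_eq_continuous _ _ _ (fun t => `|k t| `^ p)).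
  by move=> t tD; rewrite /= ger0_norm// k0.
move=> x; apply: (@continuous_comp (subspace D) R R k (fun x => `|x| `^ p)).
  exact: ck.
exact: continuous_powR_norm.
Qed.

Lemma within_continuous_mean (R : realType) (H : R -> R) :
  {within `[0, 1], continuous H} ->
  {within `]0, 1], continuous (fun t => H t / t)}.
Proof.
move=> cH x; apply: continuousM.
  by apply: continuous_subspaceW cH x; exact: subset_itv_oc_cc.
apply: (@derivable_within_continuous _ _ (fun t : R => t^-1) `]0, 1]%R) => t.
rewrite in_itv/= => /andP[t0 _]; apply: derivableV => //; exact: lt0r_neq0.
Qed.

(** The derivative [(t * h t - H t) / t ^ 2] of the mean is nonpositive by [antiderivative_ge]. *)
Lemma mean_nonincreasing (R : realType) (h H : R -> R) :
  {in `]0, 1] &, nonincreasing_fun h} -> H 0 = 0 ->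
  {within `[0, 1], continuous H} ->
  {in `]0, 1[, forall t : R, is_derive t 1 H (h t)} ->
  {in `]0, 1] &, nonincreasing_fun (fun t => H t / t)}.
Proof.
move=> hni H0 cH dH.
have dG (t : R) : t \in `]0, 1[ ->
    is_derive t 1 (fun t => H t / t) ((t * h t - H t) / t ^+ 2).
  move=> tI; have /andP[t0 t1] : 0 < t < 1 by rewrite in_itv/= in tI.
  have dHt := dH _ tI.
  have dV := is_deriveV (lt0r_neq0 t0) (is_derive_id t (1 : R)).
  have dHV := is_deriveM dHt dV.
  apply: (is_derive_eq dHV).
  by rewrite /GRing.scale/=; field; rewrite gt_eqF.
have cG := within_continuous_mean cH.
move=> x y xI yI xy; apply: (ler0_derive1_le_oc _ _ cG) => // t tI.
  exact: (@ex_derive _ _ _ _ _ _ _ (dG t tI)).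
have /andP[t0 t1] : 0 < t < 1 by rewrite in_itv/= in tI.
rewrite derive1E (@derive_val _ _ _ _ _ _ _ (dG t tI)).
rewrite pmulr_lle0 ?invr_gt0 ?exprn_gt0// subr_le0.
by apply: antiderivative_ge hni H0 cH dH _; rewrite in_itv/= t0 ltW.
Qed.

(** * The equality case forces a differential equation *)

(** [H], [J] and [K] are the antiderivatives of [h], [G ^ p] and [h ^ p] that vanish at 0; their
    values at 1 encode the three integral conditions. The conclusion is the equation
    [z * H' = H / t]. *)
Lemma hardy_equality (R : realType) (p z f F : R) (h H J K : R -> R)
    (G := fun t => H t / t) :
  1 < p -> 1 <= z -> 0 < f -> Hp p z * F = f `^ p ->
  {in `]0, 1], forall t, 0 <= h t} -> {in `]0, 1] &, nonincreasing_fun h} ->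
  H 0 = 0 -> H 1 = f -> {within `[0, 1], continuous H} ->
  {in `]0, 1[, forall t : R, is_derive t 1 H (h t)} ->
  J 0 = 0 -> J 1 = F * z `^ p -> {within `[0, 1], continuous J} ->
  {in `]0, 1[, forall t : R, is_derive t 1 J (G t `^ p)} ->
  K 0 = 0 -> K 1 = F -> {within `[0, 1], continuous K} ->
  {in `]0, 1[, forall t : R, is_derive t 1 K (h t `^ p)} ->
  {in `]0, 1[, forall t, z * h t = G t}.
Proof.
move=> p1 z1 f0 HpzF h0 hni H0 H1 cH dH J0 J1 cJ dJ K0 K1 cK dK.
have p0 : 0 < p by rewrite (lt_trans _ p1).
have z0 : 0 < z by rewrite (lt_le_trans _ z1).
have Gni : {in `]0, 1] &, nonincreasing_fun G}.
  exact: mean_nonincreasing hni H0 cH dH.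
have i1 : 1 \in `]0, 1 : R] by rewrite in_itv/= ltr01 lexx.
(* By monotonicity [G] is at least [G 1 = f > 0]. Positivity allows [G ^ p] to be differentiated and
   Young's inequality to be applied. *)
have G0 : {in `]0, 1], forall t, 0 < G t}.
  move=> t tI; rewrite (@lt_le_trans _ _ (G 1)) ?Gni//.
    by rewrite /G H1 divr1.
  by move: tI; rewrite in_itv => /andP[].
have Gpni : {in `]0, 1] &, nonincreasing_fun (fun t => G t `^ p)}.
  move=> x y xI yI xy; apply: ge0_ler_powR; rewrite ?nnegrE ?(ltW p0)//.
  - by rewrite ltW// G0.
  - by rewrite ltW// G0.
  - exact: Gni.
have K_ge0 : {in `]0, 1], forall t, 0 <= K t}.
  move=> t tI; have hpni : {in `]0, 1] &, nonincreasing_fun (fun t => h t `^ p)}.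
    move=> x y xI yI xy; apply: ge0_ler_powR; rewrite ?nnegrE ?(ltW p0) ?h0//.
    exact: hni.
  apply: le_trans (antiderivative_ge hpni K0 cK dK tI).
  by rewrite mulr_ge0 ?powR_ge0//; move: tI; rewrite in_itv/= => /andP[/ltW].
(* Antiderivative of the defect [dPhi] in Young's inequality.  It avoids improper
   integrals: it is nondecreasing, vanishes at 1, and is at least [- C * J t],
   which tends to 0 at 0+, since [t * G t `^ p <= J t] by monotonicity of [G]. *)
pose Phi t := z `^ p * K t + (p - 1) * (1 - z) * J t - z * (t * G t `^ p).
pose dPhi t := (z * h t) `^ p + (p - 1) * G t `^ p - p * G t `^ (p - 1) * (z * h t).
(* Since [G' = (h - G) / t], the coefficients of [G ^ p] add up to
   [(p - 1) * (1 - z) - z + p * z = p - 1]. *)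
have dPhiE (t : R) : t \in `]0, 1[ -> is_derive t 1 Phi (dPhi t).
  move=> tI; have /andP[t0 t1] : 0 < t < 1 by rewrite in_itv/= in tI.
  have tI' : t \in `]0, 1] by rewrite in_itv/= t0 ltW.
  have dHt := dH _ tI; have dJt := dJ _ tI; have dKt := dK _ tI.
  have dV := is_deriveV (lt0r_neq0 t0) (is_derive_id t (1 : R)).
  have dG : is_derive t 1 G (t^-1 * (h t - G t)).
    apply: (is_derive_eq (is_deriveM dHt dV)).
    by rewrite /GRing.scale/= /G; field; rewrite gt_eqF.
  have dp : is_derive (G t) 1 (fun x : R => x `^ p) (p * G t `^ (p - 1)).
    by apply: is_derive1_powR; exact: G0.
  have dGp := is_derive1_comp dp dG.
  have dtGp := is_deriveM (is_derive_id t (1 : R)) dGp.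
  have dd := is_deriveB (is_deriveD (is_deriveZ (z `^ p) dKt)
    (is_deriveZ ((p - 1) * (1 - z)) dJt)) (is_deriveZ z dtGp).
  apply: (is_derive_eq dd); rewrite /GRing.scale/= /dPhi.
  rewrite powRM ?(ltW z0) ?h0//.
  rewrite -(@mulr_powRB1 _ (G t) p) ?(ltW (G0 _ tI'))//.
  by field; rewrite gt_eqF.
have young : {in `]0, 1[, forall t, 0 <= dPhi t}.
  move=> t tI; have tI' : t \in `]0, 1].
    by move: tI; rewrite !in_itv/= => /andP[-> /ltW].
  rewrite /dPhi; have [->|zhG] := eqVneq (z * h t) (G t).
    rewrite -(@mulr_powRB1 _ (G t) p) ?(ltW (G0 _ tI'))//.
    by rewrite le_eqVlt; apply/orP; left; apply/eqP; ring.
  rewrite subr_ge0 ltW//; apply: powR_young_lt => //; first exact: G0.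
  by rewrite mulr_ge0 ?h0 ?ltW.
(* Here the choice of [z] enters: substituting [f ^ p = Hp p z * F] makes the three terms cancel. *)
have Phi1 : Phi 1 = 0.
  rewrite /Phi J1 K1 /G H1 divr1 mul1r -HpzF /Hp -(@mulr_powRB1 _ z p) ?(ltW z0)//.
  by ring.
have cPhi : {within `]0, 1], continuous Phi}.
  have oc A : A = K \/ A = J -> {within `]0, 1], continuous A}.
    have sub : `]0, 1]%classic `<=` `[0 : R, 1]%classic by exact: subset_itv_oc_cc.
    by case=> ->; [exact: continuous_subspaceW cK|exact: continuous_subspaceW cJ].
  have cid : {within `]0, 1], continuous (@id R)}.
    by apply: continuous_subspaceT => x; exact: cvg_id.
  have cGp : {within `]0, 1], continuous (fun t => G t `^ p)}.
    apply: within_continuous_powR => //; last exact: within_continuous_mean.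
    by move=> t; rewrite inE => /G0/ltW.
  have ccst (c : R) : {within `]0, 1], continuous (fun _ : R => c)}.
    by apply: continuous_subspaceT => x; exact: cst_continuous.
  have cM (A B : R -> R) : {within `]0, 1], continuous A} -> {within `]0, 1], continuous B} ->
      {within `]0, 1], continuous (fun t : R => A t * B t)}.
    by move=> cA cB x; apply: continuousM; [exact: cA|exact: cB].
  have cK' := cM _ _ (ccst (z `^ p)) (oc K (or_introl erefl)).
  have cJ' := cM _ _ (ccst ((p - 1) * (1 - z))) (oc J (or_intror erefl)).
  have cG' := cM _ _ (ccst z) (cM _ _ cid cGp).
  exact: (within_continuousB (within_continuousD cK' cJ') cG').
have Phi_nd : {in `]0, 1] &, {homo Phi : x y / x <= y}}.
  apply: ger0_derive1_le_oc cPhi => t tI.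
    exact: (@ex_derive _ _ _ _ _ _ _ (dPhiE t tI)).
  by rewrite derive1E (@derive_val _ _ _ _ _ _ _ (dPhiE t tI)) young.
have Phi_le0 : {in `]0, 1], forall t, Phi t <= 0}.
  move=> t tI; rewrite -Phi1 Phi_nd//.
  by move: tI; rewrite in_itv/= => /andP[].
(* Dropping [z ^ p * K t] and replacing [t * G t ^ p] by its upper bound [J t] leaves exactly
   [- C * J t]. *)
pose C := (p - 1) * (z - 1) + z.
have C0 : 0 < C by rewrite /C ltr_wpDl// mulr_ge0 ?subr_ge0// ltW.
have Phi_geJ : {in `]0, 1], forall t, - (C * J t) <= Phi t}.
  move=> t tI; have tGJ := antiderivative_ge Gpni J0 cJ dJ tI.
  rewrite /Phi /C -subr_ge0.
  have e1 : 0 <= z `^ p * K t by rewrite mulr_ge0 ?powR_ge0 ?K_ge0.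
  have e2 : 0 <= z * (J t - t * G t `^ p) by rewrite mulr_ge0 ?subr_ge0// ltW.
  rewrite (le_trans (addr_ge0 e1 e2))// le_eqVlt; apply/orP; left; apply/eqP.
  by ring.
have Phi_ge0 : {in `]0, 1], forall t, 0 <= Phi t}.
  move=> t tI; rewrite leNgt; apply/negP => Phit0.
  have [_ J0r _] := (continuous_within_itvP _ ltr01).1 cJ.
  rewrite J0 in J0r.
  (* If [Phi t] were negative, monotonicity of [Phi] would keep [J s] at or above this positive
     number for all [0 < s <= t], whereas [J s] tends to 0. *)
  have e0 : 0 < - Phi t / C by rewrite divr_gt0// oppr_gt0.
  have t0 : 0 < t by move: tI; rewrite in_itv/= => /andP[].
  have /cvgrPdist_lt/(_ _ e0) Js := J0r.
  near (0 : R)^'+ => s.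
  have s0 : 0 < s by [].
  have st : s <= t by near: s; exact: nbhs_right_le.
  have sI : s \in `]0, 1].
    by move: tI; rewrite !in_itv/= s0/= => /andP[_]; exact: le_trans.
  have : `|0 - J s| < - Phi t / C by near: s.
  rewrite sub0r normrN ltr_pdivlMr// ltNge => /negP; apply.
  have := le_trans (Phi_geJ s sI) (Phi_nd s t sI tI st).
  rewrite lerNl => /le_trans; apply.
  by rewrite mulrC ler_pM2r// ler_norm.
have Phi0 : {in `]0, 1], forall t, Phi t = 0}.
  by move=> t tI; apply/eqP; rewrite eq_le Phi_le0// Phi_ge0.
move=> t tI; have /andP[t0 t1] : 0 < t < 1 by rewrite in_itv/= in tI.
have tI' : t \in `]0, 1] by rewrite in_itv/= t0 ltW.
(* [Phi] vanishes on a neighbourhood of [t], so its derivative, the defect in Young's inequality, is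
   0 there. *)
have dPhi0 : dPhi t = 0.
  rewrite -(@derive_val _ _ _ _ _ _ _ (dPhiE t tI)).
  rewrite (@near_eq_derive _ _ _ Phi (cst 0)) ?derive_cst//.
  have := @near_in_itvoo R 0 1 t tI.
  apply: filterS => x; rewrite in_itv/= => /andP[x0 x1].
  by rewrite Phi0// in_itv/= x0 ltW.
apply/eqP; rewrite -[_ == _]negbK; apply/negP => zhG.
have zh0 : 0 <= z * h t by rewrite mulr_ge0 ?h0 ?ltW.
have := powR_young_lt p1 (G0 _ tI') zh0 zhG.
by rewrite -subr_gt0 -/(dPhi t) dPhi0 ltxx.
Unshelve. all: by end_near. Qed.

(** * The power function is an extremizer *)

(** For negative [b] the integrand is unbounded at 0. Hence []0, t]] is exhausted by compact
    intervals on which the fundamental theorem applies, and the limit is taken by monotone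
    convergence. *)
Lemma integral_powR (R : realType) (c b t : R) : 0 <= c -> -1 < b -> 0 < t ->
  (\int[mu]_(u in `]0%R, t]) (c * u `^ b)%:E = (c * (t `^ (b + 1) / (b + 1)))%:E)%E.
Proof.
move=> c0 b1 t0.
have s0 : 0 < b + 1 by rewrite -(opprK 1) subr_gt0.
(* The shift by 2 gives [a n < t] already for [n = 0]. *)
pose a (n : nat) : R := t / n.+2%:R.
have a0 n : 0 < a n by rewrite divr_gt0.
have at_ n : a n < t by rewrite ltr_pdivrMr// ltr_pMr// ltr1n.
have Un : `]0, t]%classic = \bigcup_n `[a n, t]%classic.
  apply/seteqP; split => x /=.
    rewrite in_itv/= => /andP[x0 xt].
    (* With [n] the integer part of [t / x], [t / x < n + 1 < n + 2], so [a n < x]. *)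
    exists (Num.truncn (t / x)) => //=; rewrite in_itv/= xt andbT.
    rewrite ler_pdivrMr// mulrC -ler_pdivrMr//.
    apply: ltW; apply: lt_trans (truncnS_gt _) _.
    by rewrite ltr_nat.
  by move=> [n _] /=; rewrite !in_itv/= => /andP[anx ->]; rewrite (lt_le_trans (a0 n)).
have cpow (x : R) e : 0 < x -> {for x, continuous (fun u : R => u `^ e)}.
  move=> x0; apply/differentiable_continuous/derivable1_diffP/derivable_powR.
  by rewrite in_itv/= x0.
pose A (u : R) := c / (b + 1) * u `^ (b + 1).
have cA (x : R) : 0 < x -> {for x, continuous A}.
  by move=> x0; apply: (@continuousM R R (cst _)); [exact: cst_continuous|exact: cpow].
have dA (x : R) : 0 < x -> is_derive x 1 A (c * x `^ b).
  move=> x0; have dd := is_deriveZ (c / (b + 1)) (is_derive1_powR (b + 1) x0).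
  apply: (is_derive_eq dd); rewrite addrK /GRing.scale/=.
  by field; rewrite gt_eqF.
have IE n : (\int[mu]_(u in `[a n, t]) (c * u `^ b)%:E = (A t - A (a n))%:E)%E.
  rewrite (@continuous_FTC2 _ _ A) ?EFinB//.
  - apply: derivable_within_continuous => x; rewrite in_itv/= => /andP[ax _].
    apply: derivableM => //; apply: derivable_powR.
    by rewrite in_itv/= (lt_le_trans (a0 n)).
  - split.
    + move=> x; rewrite in_itv/= => /andP[ax _].
      exact: (@ex_derive _ _ _ _ _ _ _ (dA x (lt_trans (a0 n) ax))).
    + by apply: cvg_at_right_filter; exact: cA.
    + by apply: cvg_at_left_filter; exact: cA.
  - move=> x; rewrite in_itv/= => /andP[ax _].
    by rewrite derive1E (@derive_val _ _ _ _ _ _ _ (dA x (lt_trans (a0 n) ax))).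
have cvg1 : (fun n => \int[mu]_(u in `[a n, t]) (c * u `^ b)%:E)%E @ \oo -->
    (\int[mu]_(u in `]0%R, t]) (c * u `^ b)%:E)%E.
  rewrite Un; apply: ge0_nondecreasing_set_cvg_integral => //.
  - move=> m n mn; rewrite subsetEset; apply: subset_itvr.
    by rewrite bnd_simp ler_pM2l// lef_pV2 ?posrE// ler_nat !ltnS.
  - move=> n; apply/measurable_EFinP.
    by apply: measurable_funTS; apply: measurable_funM => //; exact: measurable_powR.
  - by move=> n x _; rewrite lee_fin mulr_ge0 ?powR_ge0.
have cvg2 : (fun n => \int[mu]_(u in `[a n, t]) (c * u `^ b)%:E)%E @ \oo -->
    (c * (t `^ (b + 1) / (b + 1)))%:E.
  rewrite (_ : (fun n => _) = (fun n => (A t - A (a n))%:E)); last exact/funext.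
  apply: cvg_EFin; first exact: nearW.
  have acvg : a n @[n --> \oo] --> 0.
    rewrite -(mulr0 t); apply: cvgM; first exact: cvg_cst.
    exact: (cvg_comp _ _ (cvg_addnl 1) (@cvg_harmonic R)).
  (* The absolute value is inserted to use continuity at the limit point 0, and is removed at the
     end as [a n] is positive. *)
  have : (fun n => `|a n| `^ (b + 1)) @ \oo --> `|0 : R| `^ (b + 1).
    apply: (cvg_comp a (fun x : R => `|x| `^ (b + 1)) acvg).
    exact: continuous_powR_norm.
  rewrite normr0 powR0 ?gt_eqF// => acvg'.
  have -> : c * (t `^ (b + 1) / (b + 1)) = A t - c / (b + 1) * 0.
    by rewrite /A mulr0 subr0 mulrA mulrAC.
  apply: cvgB; first exact: cvg_cst.
  apply: cvgM; first exact: cvg_cst.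
  apply: cvg_trans acvg'; apply: near_eq_cvg; apply: nearW => n.
  by rewrite gtr0_norm.
exact: (cvg_unique (@ereal_hausdorff R) cvg1 cvg2).
Qed.

(** The mean of this [g] over []0, t]] is [f * t ^ (1 / z - 1)], that is [z * g t]. The two
    integrals of [p]-th powers are therefore [(f / z) ^ p / s] and [f ^ p / s], and
    [Hp p z = z ^ p * s] identifies them with [F] and [F * z ^ p]. *)
Lemma extremizer_powR (R : realType) (p f F z : R) :
  1 < p -> 0 < f -> 1 <= z -> z < p / (p - 1) -> Hp p z * F = f `^ p ->
  z = omega p (f `^ p / F) ->
  extremizer p f F (fun u => f / z * u `^ (z^-1 - 1)).
Proof.
move=> p1 f0 z1 zc HpzF zE.
have p0 : 0 < p by rewrite (lt_trans _ p1).
have z0 : 0 < z by rewrite (lt_le_trans _ z1).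
have zV1 : z^-1 <= 1 by rewrite invf_le1.
have zV0 : 0 < z^-1 by rewrite invr_gt0.
have fz0 : 0 < f / z by rewrite divr_gt0.
(* One plus the exponent of [u] in [g u ^ p]; it is positive exactly because [z < p / (p - 1)]. *)
pose s := (z^-1 - 1) * p + 1.
have s0 : 0 < s.
  have : p - 1 < p / z by rewrite ltr_pdivlMr// mulrC -ltr_pdivlMr// subr_gt0.
  by rewrite /s; lra.
have HpE : Hp p z = z `^ p * s.
  rewrite /Hp /s -(@mulr_powRB1 _ z p) ?(ltW z0)//.
  by field; rewrite gt_eqF.
have meanE t : 0 < t ->
    (\int[mu]_(u in `]0%R, t]) (f / z * u `^ (z^-1 - 1))%:E =
     (t * (f * t `^ (z^-1 - 1)))%:E)%E.
  move=> t0; rewrite integral_powR ?(ltW fz0)//; last by lra.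
  congr (_%:E); rewrite subrK -(@mulr_powRB1 _ t z^-1) ?(ltW t0)//.
  by field; rewrite gt_eqF.
have powI c : 0 <= c ->
    (\int[mu]_(u in `]0%R, 1%R]) (c * u `^ ((z^-1 - 1) * p))%:E = (c / s)%:E)%E.
  by move=> c0; rewrite integral_powR ?powR1 ?mul1r//; rewrite -subr_gt0 opprK.
split; split.
- by move=> t _; rewrite mulr_ge0 ?powR_ge0 ?(ltW fz0).
- move=> x y; rewrite !in_itv/= => /andP[x0 _] /andP[y0 _] xy.
  rewrite ler_pM2l// -(opprB 1) !powRN lef_pV2 ?posrE ?powR_gt0//.
  by apply: ge0_ler_powR; rewrite ?nnegrE ?subr_ge0 ?(ltW x0) ?(ltW y0).
- apply: derivable_within_continuous => t; rewrite in_itv/= => /andP[t0 _].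
  apply: derivableM => //; apply: derivable_powR.
  by rewrite in_itv/= t0.
- by rewrite meanE// powR1 mulr1 mul1r.
- transitivity (\int[mu]_(u in `]0%R, 1%R])
      ((f / z) `^ p * u `^ ((z^-1 - 1) * p))%:E)%E.
    apply: eq_integral => u _.
    by rewrite powRM ?powR_ge0 ?(ltW fz0)// -powRrM.
  rewrite powI ?powR_ge0//; congr (_%:E).
  have := HpzF; rewrite HpE powRM ?invr_ge0 ?(ltW f0) ?(ltW z0)// => <-.
  rewrite -powR_inv1 ?(ltW z0)// powRAC powR_inv1 ?powR_ge0//.
  by field; rewrite !gt_eqF ?powR_gt0.
- transitivity (\int[mu]_(t in `]0%R, 1%R])
      (f `^ p * t `^ ((z^-1 - 1) * p))%:E)%E.
    apply: eq_integral => t; rewrite inE/= in_itv/= => /andP[t0 _].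
    rewrite meanE// -EFinM mulKf ?gt_eqF// poweR_EFin.
    by rewrite powRM ?powR_ge0 ?(ltW f0)// -powRrM.
  rewrite powI ?powR_ge0//; congr (_%:E).
  by rewrite -zE -HpzF HpE; field; rewrite gt_eqF.
Qed.

(** * Uniqueness of the extremizer *)

(** [hardy_equality] yields [H t = t * z * h t] inside the interval. Solving this linear equation
    with [H 1 = f] gives [H t = f * t ^ (1 / z)], hence [h]. *)
Lemma extremizer_unique (R : realType) (p f F z : R) (h : R -> R) :
  1 < p -> 0 < f -> 1 <= z -> Hp p z * F = f `^ p ->
  z = omega p (f `^ p / F) -> extremizer p f F h ->
  {in `]0, 1], h =1 (fun u => f / z * u `^ (z^-1 - 1))}.
Proof.
move=> p1 f0 z1 HpzF zE [[h0 hni ch] [intH intK intJ]].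
have p0 : 0 < p by rewrite (lt_trans _ p1).
have z0 : 0 < z by rewrite (lt_le_trans _ z1).
have [H [H0 H1 cH dH HE]] := integral_unit_antiderivative h0 ch intH.
have cG := within_continuous_mean cH.
have H_ge0 t : t \in `]0, 1] -> 0 <= H t.
  move=> tI; apply: le_trans (antiderivative_ge hni H0 cH dH tI).
  by rewrite mulr_ge0 ?h0//; move: tI; rewrite in_itv/= => /andP[/ltW].
have G0 : {in `]0, 1], forall t, 0 <= H t / t}.
  move=> t tI; rewrite divr_ge0 ?H_ge0//.
  by move: tI; rewrite in_itv/= => /andP[/ltW].
have {}intJ : (\int[mu]_(t in `]0%R, 1%R]) ((H t / t) `^ p)%:E =
    (F * z `^ p)%:E)%E.
  rewrite zE -intJ; apply: eq_integral => t tI.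
  rewrite inE in tI.
  by rewrite HE// -EFinM poweR_EFin mulrC.
have [||J [J0 J1 cJ dJ _]] := integral_unit_antiderivative _ _ intJ.
- by move=> t _; exact: powR_ge0.
- apply: within_continuous_powR => // t; rewrite inE; exact: G0.
have [||K [K0 K1 cK dK _]] := integral_unit_antiderivative _ _ intK.
- by move=> t _; exact: powR_ge0.
- apply: within_continuous_powR => // t; rewrite inE; exact: h0.
have zhG := hardy_equality p1 z1 f0 HpzF h0 hni H0 H1 cH dH J0 J1 cJ dJ K0 K1 cK dK.
have cpow : {within `]0, 1], continuous (fun t : R => t `^ (- z^-1))}.
  apply: derivable_within_continuous => t; rewrite in_itv/= => /andP[t0 _].
  by apply: derivable_powR; rewrite in_itv/= t0.
have Hpow t : t \in `]0, 1[ -> H t = f * t `^ z^-1.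
  move=> tI; have /andP[t0 t1] : 0 < t < 1 by rewrite in_itv/= in tI.
  (* Multiplication by the integrating factor [t ^ (- 1 / z)] gives a function with zero derivative.
     Working on [[t, 1]] stays away from the singularity of this factor at 0. *)
  pose Q := H * (fun t => t `^ (- z^-1)).
  have dQ (x : R) : x \in `]t, 1[ -> is_derive x 1 Q 0.
    rewrite in_itv/= => /andP[tx x1]; have x0 := lt_trans t0 tx.
    have xI : x \in `]0, 1[ by rewrite in_itv/= x0.
    apply: (is_derive_eq (is_deriveM (dH x xI) (is_derive1_powR (- z^-1) x0))).
    have -> : H x = x * (z * h x) by rewrite zhG// mulrCA divff ?gt_eqF// mulr1.
    have -> : x `^ (- z^-1) = x `^ (- z^-1 - 1) * x.
      rewrite -[in LHS](subrK 1 (- z^-1)) powRD ?powRr1 ?(ltW x0)//.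
      by rewrite (gt_eqF x0) implybT.
    by rewrite /GRing.scale/=; field; rewrite gt_eqF.
  have cQ : {within `[t, 1], continuous Q}.
    have st1 : `[t, 1]%classic `<=` `[0, 1]%classic.
      by apply: subset_itvr; rewrite bnd_simp ltW.
    have st2 : `[t, 1]%classic `<=` `]0, 1]%classic by exact: subset_itvr.
    move=> x; apply: continuousM.
      exact: (continuous_subspaceW st1 cH).
    exact: (continuous_subspaceW st2 cpow).
  have [c _] := MVT t1 dQ cQ.
  rewrite mul0r /Q /= !mulrfctE H1 powR1 mulr1 => /eqP; rewrite subr_eq0 => /eqP ->.
  by rewrite powRN divfK// gt_eqF// powR_gt0.
have hE t : t \in `]0, 1[ -> h t = f / z * t `^ (z^-1 - 1).
  move=> tI; have /andP[t0 t1] : 0 < t < 1 by rewrite in_itv/= in tI.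
  apply: (mulfI (lt0r_neq0 z0)); rewrite zhG// Hpow//.
  rewrite powRB ?(gt_eqF t0) ?implybT// powRr1 ?(ltW t0)//.
  by field; rewrite !gt_eqF.
(* The formula for [h] is known only in the open interval; at 1 it follows by left continuity of
   both sides. *)
move=> t; rewrite in_itv/= => /andP[t0]; rewrite le_eqVlt => /predU1P[->|t1]; last first.
  by rewrite hE// in_itv/= t0.
have h1 : h x @[x --> 1^'-] --> h 1.
  have ch' : {within `[2^-1, 1], continuous h}.
    by apply: continuous_subspaceW ch; apply: subset_itvr; rewrite bnd_simp.
  have lt_half1 : 2^-1 < 1 :> R by lra.
  by have [] := (continuous_within_itvP _ lt_half1).1 ch'.
have g1 : h x @[x --> 1^'-] --> f / z * 1 `^ (z^-1 - 1).
  have cp : {for 1, continuous (fun u : R => u `^ (z^-1 - 1))}.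
    apply/differentiable_continuous/derivable1_diffP/derivable_powR.
    by rewrite in_itv/= ltr01.
  have cg : f / z * x `^ (z^-1 - 1) @[x --> 1^'-] --> f / z * 1 `^ (z^-1 - 1).
    by apply: cvg_at_left_filter; apply: cvgM; [exact: cvg_cst|exact: cp].
  apply: cvg_trans cg; apply: near_eq_cvg; near=> x.
  rewrite hE// in_itv/=; apply/andP; split; last by [].
  by near: x; apply: nbhs_left_gt.
exact: (cvg_unique (@Rhausdorff R) h1 g1).
Unshelve. all: by end_near. Qed.

Theorem theorem2 (R : realType) (p f F : R) (hp : 1 < p) (hf : 0 < f)
    (hfF : f `^ p <= F) :
  exists g : R -> R, extremizer p f F g /\
    forall h : R -> R, extremizer p f F h -> {in `]0, 1], h =1 g}.
Proof.
have fp0 : 0 < f `^ p by rewrite powR_gt0.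
have F0 : 0 < F by rewrite (lt_le_trans fp0).
have v01 : 0 < f `^ p / F <= 1 by rewrite divr_gt0//= ler_pdivrMr// mul1r.
have [z1 zc Hz] := omegaP hp v01.
have HzF : Hp p (omega p (f `^ p / F)) * F = f `^ p by rewrite Hz divfK ?gt_eqF.
eexists; split; first exact: extremizer_powR hp hf z1 zc HzF erefl.
move=> h; exact: extremizer_unique hp hf z1 HzF erefl.
Qed.
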